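(* Let $G=(V,E)$ be a finite simple graph with $E=\{e_1,\dots,e_m\}$, and let $T$ be its Hashimoto matrix on $\mathbb R^{\vec E}$ ($\vec E$ the $2m$ directed edges), $T_{(u,v),(x,y)}=1$ if $v=x$ and $y\neq u$, else $0$. Fix a reference orientation of each edge $e$, write $e^+$ for the directed edge in the reference direction and $e^-$ for its reverse, and set \[\phi_e^\pm=\tfrac1{\sqrt2}(\mathbf e_{e^+}\pm\mathbf e_{e^-}).\] Let $Q$ be the orthogonal $2m\times 2m$ matrix whose columns are $\phi_{e_1}^+,\dots,\phi_{e_m}^+,\phi_{e_1}^-,\dots,\phi_{e_m}^-$. Let $D$ be the oriented incidence matrix ($D_{v,e}=+1$ if $v$ is the head of $e$ under the reference orientation, $-1$ if $v$ is its tail, $0$ otherwise), $|D|$ its entrywise absolute value, $L=|D|^\top|D|-2I$ and $S=D^\top D-2I$ ($I$ the $m\times m$ identity). Then \[Q^\top TQ=\begin{pmatrix}\tfrac12 L & -\tfrac12|D|^\top D\\[2pt] \tfrac12 D^\top|D| & -\tfrac12 S\end{pmatrix}.\] Equivalently, the compression of $T$ to the $+1$-eigenspace of edge reversal is $\tfrac12L$, to the $-1$-eigenspace is $-\tfrac12S$, and the cross-couplings are the mixed incidence products shown.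
   Context: $L$ is the adjacency matrix of the line graph of $G$ and $S$ is the signed adjacency matrix of the antisymmetric line graph of $G$. Edge reversal is the involution $(u,v)\mapsto(v,u)$ on directed edges; $\phi_e^\pm$ are its $\pm1$ eigenvectors. *)

(* Defs.v *)
From HB Require Import structures.
From mathcomp Require Import all_boot all_order all_algebra.

Set Implicit Arguments.
Unset Strict Implicit.
Unset Printing Implicit Defensive.

Import Order.TTheory GRing.Theory Num.Theory.
Local Open Scope ring_scope.

Record sgraph := SGraph {
  vertex :> finType;
  adj : rel vertex;
  adj_sym : symmetric adj;
  adj_irrefl : irreflexive adj
}.

(* The pair (u, v) is the edge uv directed from its tail u to its head v. *)
Definition dedge (G : sgraph) : finType := {p : G * G | adj p.1 p.2}.

Definition tail (G : sgraph) (a : dedge G) : G := (val a).1.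
Definition head (G : sgraph) (a : dedge G) : G := (val a).2.

Lemma rev_subproof (G : sgraph) (a : dedge G) : adj (head a) (tail a).
Proof. by rewrite adj_sym; exact: (valP a). Qed.

Definition rev (G : sgraph) (a : dedge G) : dedge G :=
  exist (fun p : G * G => adj p.1 p.2) (head a, tail a) (rev_subproof a).

Definition undirected (G : sgraph) (a : dedge G) : {set G} :=
  [set tail a; head a].

Definition edge_set (G : sgraph) : {set {set G}} :=
  [set undirected a | a : dedge G].

Section Matrices.
Variables (R : rcfType) (G : sgraph).

(* Vectors and matrices over directed edges (resp. vertices) are indexed
   through enum_val : 'I_#|dedge G| -> dedge G (resp. 'I_#|G| -> G). *)
Definition hashimoto : 'M[R]_#|dedge G| :=
  \matrix_(i, j)
    ((head (enum_val i) == tail (enum_val j))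
       && (head (enum_val j) != tail (enum_val i)))%:R.

Definition dvec (a : dedge G) : 'cV[R]_#|dedge G| := delta_mx (enum_rank a) 0.

(* The linear map sending dvec a to dvec (rev a), acting on columns. *)
Definition reversal : 'M[R]_#|dedge G| :=
  \matrix_(i, j) (enum_val i == rev (enum_val j))%:R.

Section Orientation.
(* ep j is the j-th edge taken in its reference direction. *)
Variables (m : nat) (ep : 'I_m -> dedge G).

Definition phi_plus (j : 'I_m) : 'cV[R]_#|dedge G| :=
  (Num.sqrt 2)^-1 *: (dvec (ep j) + dvec (rev (ep j))).

Definition phi_minus (j : 'I_m) : 'cV[R]_#|dedge G| :=
  (Num.sqrt 2)^-1 *: (dvec (ep j) - dvec (rev (ep j))).

Definition Phi_plus : 'M[R]_(#|dedge G|, m) := \matrix_(i, j) phi_plus j i 0.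
Definition Phi_minus : 'M[R]_(#|dedge G|, m) := \matrix_(i, j) phi_minus j i 0.

Definition Qmx : 'M[R]_(#|dedge G|, m + m) := row_mx Phi_plus Phi_minus.

Definition incidence : 'M[R]_(#|G|, m) :=
  \matrix_(i, j) if enum_val i == head (ep j) then 1
                 else if enum_val i == tail (ep j) then -1 else 0.

Definition abs_incidence : 'M[R]_(#|G|, m) := map_mx Num.norm incidence.

Definition Lmx : 'M[R]_m := abs_incidence^T *m abs_incidence - 2%:M.
Definition Smx : 'M[R]_m := incidence^T *m incidence - 2%:M.

End Orientation.

(* Subspaces of column vectors are represented, as in mxalgebra, by the row
   space of a matrix of transposed vectors. *)
Definition col_eigenspace n (A : 'M[R]_n) (a : R) : 'M[R]_n := eigenspace A^T a.

(* Orthogonal projector onto W, acting on columns; the rows of kermx W^T span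
   the orthogonal complement of W. *)
Definition orthoproj n (W : 'M[R]_n) : 'M[R]_n := (proj_mx W (kermx W^T))^T.

(* M is the matrix, with respect to the bases given by the columns of B (of the
   source subspace) and of B' (of W'), of x |-> P_{W'} (A x).  When W' is also
   the source and B' = B, this is the matrix of the compression of A to W'. *)
Definition block_of n k (A W' : 'M[R]_n) (B B' : 'M[R]_(n, k)) (M : 'M[R]_k) :=
  orthoproj W' *m A *m B = B' *m M.

End Matrices.

(* Main.v *)
(** Let H and K be the head and tail incidence matrices of all directed edges
    and J the edge reversal, so that T = H^T K - J, the reversal accounting for
    the forbidden backtracking.  The columns of Phi_plus and Phi_minus form an
    orthonormal basis on which J is 1 and -1, and, writing s = 1/sqrt 2, one has
    H Phi_plus = K Phi_plus = s |D|, H Phi_minus = s D, K Phi_minus = - s D.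
    Hence every block of Q^T T Q is a product of incidence matrices, corrected
    by the identity on the diagonal. *)
Require Import Defs.
From HB Require Import structures.
From mathcomp Require Import all_boot all_order all_algebra.
(* Imported again: [head] and [rev] now denote operations on sequences. *)
Import Defs.

Set Implicit Arguments.
Unset Strict Implicit.
Unset Printing Implicit Defensive.

Import Order.TTheory GRing.Theory Num.Theory.
Local Open Scope ring_scope.

(** * Directed edges and their reversal *)

Section DirectedEdges.
Variable G : sgraph.
Implicit Types a b : dedge G.

Lemma dedge_eqE a b : (a == b) = (tail a == tail b) && (head a == head b).
Proof. by []. Qed.

Lemma revK : involutive (@rev G).
Proof. by move=> a; apply/eqP; rewrite dedge_eqE !eqxx. Qed.

Lemma head_neq_tail a : head a != tail a.
Proof.
apply/eqP => ht; have := rev_subproof a.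
by rewrite ht adj_irrefl.
Qed.

Lemma rev_neq a : rev a != a.
Proof. by rewrite dedge_eqE negb_and head_neq_tail. Qed.

Lemma undirected_rev a : undirected (rev a) = undirected a.
Proof. exact: setUC. Qed.

(** Since [tail a] and [head a] differ, a two-element set of endpoints has only two orderings. *)
Lemma undirected_eq a b :
  undirected a = undirected b -> (a == b) || (a == rev b).
Proof.
move=> ab; rewrite !dedge_eqE /=.
have /set2P ta : tail a \in undirected b by rewrite -ab set21.
have /set2P ha : head a \in undirected b by rewrite -ab set22.
have := head_neq_tail a.
by case: ta ha => -> [] ->; rewrite !eqxx ?orbT.
Qed.

End DirectedEdges.

(** * Matrices with indicator columns *)

Section IndicatorMatrix.
Variable R : rcfType.

(* Column j is the basis vector of f j; the composition laws below turn all
   entrywise computations with incidences into matrix algebra. *)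
Definition indmx (T : finType) n (f : 'I_n -> T) : 'M[R]_(#|T|, n) :=
  \matrix_(i, j) (enum_val i == f j)%:R.

Lemma eq_indmx (T : finType) n (f g : 'I_n -> T) : f =1 g -> indmx f = indmx g.
Proof. by move=> fg; apply/matrixP => i j; rewrite !mxE fg. Qed.

Lemma tr_indmx_mul (T : finType) n p (f : 'I_n -> T) (g : 'I_p -> T) :
  (indmx f)^T *m indmx g = \matrix_(i, j) (f i == g j)%:R.
Proof.
apply/matrixP => i j; rewrite !mxE (bigD1 (enum_rank (f i))) //= !mxE.
rewrite enum_rankK eqxx mul1r big1 ?addr0 // => k kf; rewrite !mxE.
by rewrite (can2_eq enum_valK enum_rankK) (negbTE kf) mul0r.
Qed.

Lemma indmx_mul (T U : finType) n (h : T -> U) (f : 'I_n -> T) :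
  indmx (h \o enum_val) *m indmx f = indmx (h \o f).
Proof.
apply/matrixP => i j; rewrite !mxE (bigD1 (enum_rank (f j))) //= !mxE.
rewrite /= enum_rankK eqxx mulr1 big1 ?addr0 // => k kf; rewrite !mxE.
by rewrite (can2_eq enum_valK enum_rankK k) (negbTE kf) mulr0.
Qed.

(** By injectivity at most one column meets a given row, so the product is the diagonal projector
    onto the coordinates in the image of [f]. *)
Lemma indmx_mul_tr (T : finType) n (f : 'I_n -> T) (i k : 'I_#|T|) :
  injective f ->
  (indmx f *m (indmx f)^T) i k = ((i == k) && (enum_val i \in codom f))%:R.
Proof.
move=> f_inj; rewrite !mxE.
case: (boolP (enum_val i \in codom f)) => [/codomP [j ij]|ni]; last first.
  rewrite andbF big1 // => j _; rewrite !mxE.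
  case: eqP => [ij|_]; last by rewrite mul0r.
  by rewrite ij codom_f in ni.
rewrite (bigD1 j) //= !mxE -ij eqxx mul1r (inj_eq enum_val_inj) eq_sym andbT.
rewrite big1 ?addr0 // => l lj; rewrite !mxE ij (inj_eq f_inj) eq_sym.
by rewrite (negbTE lj) mul0r.
Qed.

End IndicatorMatrix.

(** * Transposition, orthogonal projectors and eigenspaces *)

Section Transpose.
Variables (R : pzRingType) (m n : nat).
Implicit Types A B : 'M[R]_(m, n).

Lemma trmxD A B : (A + B)^T = A^T + B^T. Proof. exact: linearD. Qed.

Lemma trmxB A B : (A - B)^T = A^T - B^T. Proof. exact: linearB. Qed.

Lemma trmxZ (a : R) A : (a *: A)^T = a *: A^T. Proof. exact: linearZ. Qed.

End Transpose.

Lemma orthoprojE (R : rcfType) n k (W : 'M[R]_n) (B : 'M[R]_(n, k)) :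
  B^T *m B = 1%:M -> (B^T == W)%MS -> orthoproj W = B *m B^T.
Proof.
move=> BtB /andP[/submxP[C BW] /submxP[C' WB]].
have WtE : W^T = B *m C'^T by rewrite WB trmx_mul trmxK.
have BE : B = W^T *m C^T by rewrite -[B in LHS]trmxK BW trmx_mul.
have dx : (W :&: kermx W^T = 0)%MS.
  apply/eqP; rewrite -submx0; apply/rV_subP => v.
  rewrite sub_capmx => /andP[/submxP[u ->] /sub_kermxP uW0].
  (* Inserting [B^T *m B = 1] gives $uC' = uC'B^\top B = uWB = uWW^\top C^\top = 0$. *)
  have uC0 : u *m C' = 0.
    by rewrite -[u *m C']mulmx1 -BtB mulmxA -(mulmxA u) -WB BE mulmxA uW0 mul0mx.
  by rewrite WB mulmxA uC0 mul0mx sub0mx.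
have PW : (B *m B^T <= W)%MS by rewrite BW mulmxA submxMl.
have QK : (1%:M - B *m B^T <= kermx W^T)%MS.
  apply/sub_kermxP; rewrite WtE mulmxBl mul1mx -(mulmxA B) (mulmxA B^T) BtB.
  by rewrite mul1mx subrr.
(* Split the identity: the projector fixes the rows of [B *m B^T] and kills those of the
   remainder. *)
rewrite /orthoproj -[proj_mx _ _]mul1mx -[1%:M](subrKC (B *m B^T)).
by rewrite mulmxDl proj_mx_id // proj_mx_0 // addr0 trmx_mul trmxK.
Qed.

(** As the projector is [B' *m B'^T], the compressions and couplings can be read off the blocks of
    $Q^\top TQ$. *)
Lemma block_of_orthonormal (R : rcfType) n k (A W : 'M[R]_n)
    (B B' : 'M[R]_(n, k)) :
  B'^T *m B' = 1%:M -> (B'^T == W)%MS -> block_of A W B B' (B'^T *m A *m B).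
Proof. by move=> ob sp; rewrite /block_of (orthoprojE ob sp) !mulmxA. Qed.

Lemma double_half (R : numDomainType) (x : R) : x = - x -> x = 0.
Proof. by move/eqP; rewrite -addr_eq0 -mulr2n mulrn_eq0 => /eqP. Qed.

(* A vector of the [a]-eigenspace is orthogonal to the columns of [C], which
   belong to the [-a]-eigenspace, so it is its own projection on those of [B]. *)
Lemma eigenspace_split (R : rcfType) n k (J : 'M[R]_n) (B C : 'M[R]_(n, k))
    (a : R) :
  a != 0 -> J^T = J -> B *m B^T + C *m C^T = 1%:M ->
  J *m B = a *: B -> J *m C = - a *: C -> (B^T == col_eigenspace J a)%MS.
Proof.
move=> a0 Jt BC JB JC; rewrite /col_eigenspace; apply/andP; split.
  by apply/eigenspaceP; rewrite -trmx_mul JB trmxZ.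
apply/rV_subP => v /eigenspaceP vJ; rewrite Jt in vJ.
have vC0 : v *m C = 0.
  have : a *: (v *m C) = - (a *: (v *m C)).
    by rewrite -scaleNr [in RHS]scalemxAr -JC mulmxA vJ -scalemxAl.
  move=> /matrixP eqv; apply/matrixP => i j; rewrite [RHS]mxE.
  move: (eqv i j); rewrite [LHS]mxE [RHS]mxE [in RHS]mxE.
  by move/double_half/eqP; rewrite mulf_eq0 (negbTE a0) => /eqP.
rewrite -[v]mulmx1 -BC mulmxDr !mulmxA vC0 mul0mx addr0.
exact: submxMl.
Qed.

(** * Incidences and reversal in the bases $\phi_e^\pm$ *)

Section Orientation.
Variables (R : rcfType) (G : sgraph) (m : nat) (ep : 'I_m -> dedge G).

(** The columns of [P] and [N] are the basis vectors of $e^+$ and $e^-$. *)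
Let P : 'M[R]_(#|dedge G|, m) := indmx R ep.
Let N : 'M[R]_(#|dedge G|, m) := indmx R (@rev G \o ep).
Let H : 'M[R]_(#|G|, #|dedge G|) := indmx R (@head G \o enum_val).
Let K : 'M[R]_(#|G|, #|dedge G|) := indmx R (@tail G \o enum_val).
Let s : R := (Num.sqrt 2)^-1.

Lemma Phi_plusE : Phi_plus R ep = s *: (P + N).
Proof.
apply/matrixP => i j; rewrite !mxE !eqxx !andbT /=.
by rewrite !(can2_eq enum_valK enum_rankK).
Qed.

Lemma Phi_minusE : Phi_minus R ep = s *: (P - N).
Proof.
apply/matrixP => i j; rewrite !mxE !eqxx !andbT /=.
by rewrite !(can2_eq enum_valK enum_rankK).
Qed.

Lemma incidenceE : incidence R ep = H *m P - K *m P.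
Proof.
rewrite !indmx_mul; apply/matrixP => i j; rewrite !mxE /=.
case: (eqVneq (enum_val i) (head _)) => [->|_].
  by rewrite (negbTE (head_neq_tail _)) subr0.
by rewrite sub0r; case: eqP; rewrite ?oppr0.
Qed.

(** Head and tail differ, so the two contributions never meet in one entry and the absolute value
    only changes the sign of the tail term. *)
Lemma abs_incidenceE : abs_incidence R ep = H *m P + K *m P.
Proof.
rewrite !indmx_mul; apply/matrixP => i j; rewrite !mxE /=.
case: (eqVneq (enum_val i) (head _)) => [->|_].
  by rewrite (negbTE (head_neq_tail _)) addr0 normr1.
by rewrite add0r; case: eqP; rewrite ?normrN1 ?normr0.
Qed.

Lemma reversalE : reversal R G = indmx R (@rev G \o enum_val).
Proof. by []. Qed.

(** An involution is its own inverse, so its permutation matrix is symmetric. *)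
Lemma reversal_sym : (reversal R G)^T = reversal R G.
Proof.
apply/matrixP => i j; rewrite !mxE.
by rewrite eq_sym (can2_eq (@revK G) (@revK G)).
Qed.

(* [head a = tail b] and [head b = tail a] hold together iff [a] is the reverse
   of [b], so discarding backtracking subtracts the reversal. *)
Lemma hashimotoE : hashimoto R G = H^T *m K - reversal R G.
Proof.
rewrite tr_indmx_mul; apply/matrixP => i j; rewrite !mxE /= dedge_eqE /=.
rewrite [tail (enum_val i) == _]eq_sym.
case: (head (enum_val i) == _); rewrite ?andbF ?andbT ?subr0 //=.
by case: (_ == _); rewrite ?subrr ?subr0.
Qed.

Lemma reversal_P : reversal R G *m P = N.
Proof. exact: indmx_mul. Qed.

Lemma reversal_N : reversal R G *m N = P.
Proof. by rewrite reversalE indmx_mul; apply: eq_indmx => j /=; rewrite revK. Qed.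

Lemma head_N : H *m N = K *m P.
Proof. by rewrite !indmx_mul. Qed.

Lemma tail_N : K *m N = H *m P.
Proof. by rewrite !indmx_mul. Qed.

Lemma head_Phi_plus : H *m Phi_plus R ep = s *: abs_incidence R ep.
Proof. by rewrite Phi_plusE abs_incidenceE -scalemxAr mulmxDr head_N. Qed.

Lemma tail_Phi_plus : K *m Phi_plus R ep = s *: abs_incidence R ep.
Proof. by rewrite Phi_plusE abs_incidenceE -scalemxAr mulmxDr tail_N addrC. Qed.

Lemma head_Phi_minus : H *m Phi_minus R ep = s *: incidence R ep.
Proof. by rewrite Phi_minusE incidenceE -scalemxAr mulmxBr head_N. Qed.

(** Reversal exchanges heads and tails; this sign produces the minus signs in the right block
    column. *)
Lemma tail_Phi_minus : K *m Phi_minus R ep = - (s *: incidence R ep).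
Proof.
by rewrite Phi_minusE incidenceE -scalemxAr mulmxBr tail_N -scalerN opprB.
Qed.

Lemma reversal_Phi_plus : reversal R G *m Phi_plus R ep = Phi_plus R ep.
Proof.
by rewrite Phi_plusE -scalemxAr mulmxDr reversal_P reversal_N addrC.
Qed.

Lemma reversal_Phi_minus : reversal R G *m Phi_minus R ep = - Phi_minus R ep.
Proof.
by rewrite Phi_minusE -scalemxAr mulmxBr reversal_P reversal_N -scalerN opprB.
Qed.

(** The left factor only sees heads and the right one only tails, which reduces each block to an
    incidence product and a reversal term. *)
Lemma hashimoto_form n p (X : 'M[R]_(#|dedge G|, n)) (Y : 'M[R]_(#|dedge G|, p)) :
  X^T *m hashimoto R G *m Y = (H *m X)^T *m (K *m Y) - X^T *m (reversal R G *m Y).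
Proof. by rewrite hashimotoE trmx_mul mulmxBr mulmxBl !mulmxA. Qed.

Lemma sqr_invsqrt2 : s * s = 2^-1.
Proof. by rewrite -invfM -expr2 sqr_sqrtr // ler0n. Qed.

Lemma mul_scaled n p q (A : 'M[R]_(n, p)) (B : 'M[R]_(p, q)) :
  (s *: A) *m (s *: B) = 2^-1 *: (A *m B).
Proof. by rewrite -scalemxAl -scalemxAr scalerA sqr_invsqrt2. Qed.

Lemma half_double n p (A : 'M[R]_(n, p)) : 2^-1 *: (A + A) = A.
Proof. by rewrite -mulr2n -scaler_nat scalerA mulVf ?scale1r ?pnatr_eq0. Qed.

Lemma half_2M n : 2^-1 *: (2%:M : 'M[R]_n) = 1%:M.
Proof. by rewrite scale_scalar_mx mulVf ?pnatr_eq0. Qed.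

(** * Orthonormality and the four blocks *)

Section Orthonormal.
Variable e : 'I_m -> {set G}.
Hypothesis e_inj : injective e.
Hypothesis ep_orient : forall j, undirected (ep j) = e j.

Lemma orient_inj : injective ep.
Proof. by move=> i j ij; apply: e_inj; rewrite -!ep_orient ij. Qed.

(** Equality would force [i = j], and no directed edge is its own reverse. *)
Lemma orient_neq_rev i j : ep i != rev (ep j).
Proof.
apply/eqP => ij; have /e_inj eij : e i = e j.
  by rewrite -!ep_orient ij undirected_rev.
by move: (rev_neq (ep j)); rewrite -ij eij eqxx.
Qed.

Lemma PtP : P^T *m P = 1%:M.
Proof.
by rewrite tr_indmx_mul; apply/matrixP => i j; rewrite !mxE (inj_eq orient_inj).
Qed.

Lemma NtN : N^T *m N = 1%:M.
Proof.
rewrite tr_indmx_mul; apply/matrixP => i j; rewrite !mxE /=.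
by rewrite (inj_eq (inv_inj (@revK G))) (inj_eq orient_inj).
Qed.

Lemma PtN : P^T *m N = 0.
Proof.
rewrite tr_indmx_mul; apply/matrixP => i j.
by rewrite !mxE /= (negbTE (orient_neq_rev i j)).
Qed.

Lemma NtP : N^T *m P = 0.
Proof. by rewrite -[LHS]trmxK trmx_mul trmxK PtN trmx0. Qed.

Lemma Phi_plus_orthonormal : (Phi_plus R ep)^T *m Phi_plus R ep = 1%:M.
Proof.
rewrite Phi_plusE trmxZ mul_scaled trmxD mulmxDl !mulmxDr.
by rewrite PtP NtN PtN NtP addr0 add0r half_double.
Qed.

Lemma Phi_minus_orthonormal : (Phi_minus R ep)^T *m Phi_minus R ep = 1%:M.
Proof.
rewrite Phi_minusE trmxZ mul_scaled trmxB mulmxBl !mulmxBr.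
by rewrite PtP NtN PtN NtP subr0 sub0r opprK half_double.
Qed.

Lemma Phi_plus_minus : (Phi_plus R ep)^T *m Phi_minus R ep = 0.
Proof.
rewrite Phi_plusE Phi_minusE trmxZ mul_scaled trmxD mulmxDl !mulmxBr.
by rewrite PtP NtN PtN NtP subr0 sub0r subrr scaler0.
Qed.

Lemma Phi_minus_plus : (Phi_minus R ep)^T *m Phi_plus R ep = 0.
Proof. by rewrite -[LHS]trmxK trmx_mul trmxK Phi_plus_minus trmx0. Qed.

Lemma hashimoto_plus_plus :
  (Phi_plus R ep)^T *m hashimoto R G *m Phi_plus R ep = 2^-1 *: Lmx R ep.
Proof.
rewrite hashimoto_form head_Phi_plus tail_Phi_plus reversal_Phi_plus.
by rewrite Phi_plus_orthonormal trmxZ mul_scaled scalerBr half_2M.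
Qed.

(** The reversal term vanishes because the two families are orthogonal. *)
Lemma hashimoto_plus_minus :
  (Phi_plus R ep)^T *m hashimoto R G *m Phi_minus R ep =
  - (2^-1 *: ((abs_incidence R ep)^T *m incidence R ep)).
Proof.
rewrite hashimoto_form head_Phi_plus tail_Phi_minus reversal_Phi_minus.
by rewrite !mulmxN Phi_plus_minus oppr0 subr0 trmxZ mul_scaled.
Qed.

Lemma hashimoto_minus_plus :
  (Phi_minus R ep)^T *m hashimoto R G *m Phi_plus R ep =
  2^-1 *: ((incidence R ep)^T *m abs_incidence R ep).
Proof.
rewrite hashimoto_form head_Phi_minus tail_Phi_plus reversal_Phi_plus.
by rewrite Phi_minus_plus subr0 trmxZ mul_scaled.
Qed.

(** Reversal is $-1$ here, so subtracting it adds the identity: $-\tfrac12D^\top D+I=-\tfrac12S$. *)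
Lemma hashimoto_minus_minus :
  (Phi_minus R ep)^T *m hashimoto R G *m Phi_minus R ep =
  - (2^-1 *: Smx R ep).
Proof.
rewrite hashimoto_form head_Phi_minus tail_Phi_minus reversal_Phi_minus.
rewrite !mulmxN Phi_minus_orthonormal trmxZ mul_scaled.
by rewrite scalerBr half_2M opprB opprK addrC.
Qed.

(** * Completeness of the basis *)

Hypothesis e_enum : [set e j | j : 'I_m] = edge_set G.

(** Each edge is listed, so [a] or [rev a] is a reference direction; by [orient_neq_rev] never
    both. *)
Lemma codom_orient_rev a : (rev a \in codom ep) = (a \notin codom ep).
Proof.
have [/codomP[i ->]|na] := boolP (a \in codom ep).
  by apply/codomP => -[j /esym/eqP]; rewrite (negbTE (orient_neq_rev j i)).
have : undirected a \in edge_set G by apply: imset_f.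
rewrite -e_enum => /imsetP[j _]; rewrite -ep_orient => /undirected_eq.
case/orP => /eqP aE; first by rewrite aE codom_f in na.
by rewrite aE revK codom_f.
Qed.

(** The summands are the diagonal projectors onto the reference directions and their reverses, which
    partition the directed edges. *)
Lemma completeness : P *m P^T + N *m N^T = 1%:M.
Proof.
have N_inj : injective (@rev G \o ep).
  exact: inj_comp (inv_inj (@revK G)) orient_inj.
apply/matrixP => i k; rewrite mxE !indmx_mul_tr ?mxE //; last exact: orient_inj.
have -> : (enum_val i \in codom (@rev G \o ep)) = (enum_val i \notin codom ep).
  rewrite -codom_orient_rev; apply/codomP/codomP => -[j] /=.
    by move=> ->; exists j; rewrite revK.
  by move=> xj; exists j; rewrite /= -xj revK.
by case: (i == k); case: (_ \in _); rewrite ?addr0 ?add0r.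
Qed.

(** The cross terms [P *m N^T] and [N *m P^T] cancel between the two summands, while the square
    terms double and absorb the factor one half. *)
Lemma Phi_completeness :
  Phi_plus R ep *m (Phi_plus R ep)^T + Phi_minus R ep *m (Phi_minus R ep)^T
  = 1%:M.
Proof.
rewrite Phi_plusE Phi_minusE !trmxZ !mul_scaled -scalerDr trmxD trmxB.
rewrite mulmxDl mulmxBl !mulmxDr !mulmxN -completeness -[RHS]half_double.
congr (_ *: _); rewrite opprB addrACA (addrACA (P *m P^T)) subrr addr0.
by rewrite [N *m P^T + _]addrC (addrACA (N *m N^T)) subrr addr0 addrACA.
Qed.

End Orthonormal.
End Orientation.

Theorem theorem4p1 (R : rcfType) (G : sgraph) (m : nat)
    (e : 'I_m -> {set G}) (e_inj : injective e)
    (e_enum : [set e j | j : 'I_m] = edge_set G)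
    (ep : 'I_m -> dedge G) (ep_orient : forall j, undirected (ep j) = e j) :
  let T := hashimoto R G in
  let Q := Qmx R ep in
  let D := incidence R ep in
  let absD := abs_incidence R ep in
  let L := Lmx R ep in
  let S := Smx R ep in
  let Phip := Phi_plus R ep in
  let Phim := Phi_minus R ep in
  let Wp := col_eigenspace (reversal R G) 1 in
  let Wm := col_eigenspace (reversal R G) (-1) in
  [/\ #|dedge G| = (m + m)%N,
      Q^T *m Q = 1%:M /\ Q *m Q^T = 1%:M,
      Q^T *m T *m Q =
        block_mx (2^-1 *: L)                (- (2^-1 *: (absD^T *m D)))
                 (2^-1 *: (D^T *m absD))    (- (2^-1 *: S)),
      (Phip^T == Wp)%MS /\ (Phim^T == Wm)%MS
    & [/\ block_of T Wp Phip Phip (2^-1 *: L),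
          block_of T Wm Phim Phim (- (2^-1 *: S)),
          block_of T Wp Phim Phip (- (2^-1 *: (absD^T *m D)))
        & block_of T Wm Phip Phim (2^-1 *: (D^T *m absD))]].
Proof.

move=> T Q D absD L S Phip Phim Wp Wm.
have pp := Phi_plus_orthonormal R e_inj ep_orient.
have mm := Phi_minus_orthonormal R e_inj ep_orient.
have pm := Phi_plus_minus R e_inj ep_orient.
have mp := Phi_minus_plus R e_inj ep_orient.
have cpl := Phi_completeness R e_inj ep_orient e_enum.
have Tpp := hashimoto_plus_plus R e_inj ep_orient.
have Tpm := hashimoto_plus_minus R e_inj ep_orient.
have Tmp := hashimoto_minus_plus R e_inj ep_orient.
have Tmm := hashimoto_minus_minus R e_inj ep_orient.
have QtQ : Q^T *m Q = 1%:M.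
  by rewrite /Q /Qmx tr_row_mx mul_col_row pp pm mp mm -scalar_mx_block.
have QQt : Q *m Q^T = 1%:M by rewrite /Q /Qmx tr_row_mx mul_row_col cpl.
have Ep : (Phip^T == Wp)%MS.
  apply: eigenspace_split cpl _ _; rewrite ?oner_neq0 ?reversal_sym //.
    by rewrite reversal_Phi_plus scale1r.
  by rewrite reversal_Phi_minus scaleN1r.
have Em : (Phim^T == Wm)%MS.
  (* For the eigenvalue $-1$ the two families exchange roles in [eigenspace_split]. *)
  rewrite addrC in cpl.
  apply: eigenspace_split cpl _ _; rewrite ?oppr_eq0 ?oner_neq0 ?reversal_sym //.
    by rewrite reversal_Phi_minus scaleN1r.
  by rewrite reversal_Phi_plus opprK scale1r.
split=> //.
(* Each one-sided inverse bounds one dimension of [Q] by the other, which counts the directed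
   edges. *)
- by apply/eqP; rewrite eqn_leq (mulmx1_min QQt) (mulmx1_min QtQ).
- by rewrite /Q /Qmx tr_row_mx mul_col_mx mul_col_row Tpp Tpm Tmp Tmm.
split.
- by rewrite -Tpp; apply: block_of_orthonormal.
- by rewrite -Tmm; apply: block_of_orthonormal.
- by rewrite -Tpm; apply: block_of_orthonormal.
- by rewrite -Tmp; apply: block_of_orthonormal.
Qed.
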